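(* For all non-negative integers $n$ and $k$, $$\sum_{j=0}^n\binom{n}{j}(-1)^jp^{n-j}W_{j+k}=(-q)^nW_{-n+k}.$$
   Context: Let $H$ be the real quaternion algebra with basis $1,i,j,k$ and (non-commutative) multiplication determined by $i^2=j^2=k^2=-1$, $ij=-ji=k$, $jk=-kj=i$, $ki=-ik=j$; real scalars commute with all quaternions. Fix real numbers $p,q$ with $q\neq0$. The Horadam sequence $w_n=w_n(w_0,w_1;p,q)$ has real initial values $w_0,w_1$ and satisfies $w_n=pw_{n-1}+qw_{n-2}$ for $n\ge 2$; it is extended to all negative indices by running the recurrence backwards (equivalently $(-q)^n w_{-n}=w_0u_{n+1}-w_1u_n$ for $n\ge0$, where $u_n=w_n(0,1;p,q)$). The Horadam quaternions are $W_n=w_n+w_{n+1}i+w_{n+2}j+w_{n+3}k$ for all integers $n$. *)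

(* Defs.v *)
From HB Require Import structures.
From mathcomp Require Import all_boot all_order all_algebra.
From mathcomp Require Import reals.
From mathcomp Require Import ring.

Set Implicit Arguments.
Unset Strict Implicit.
Unset Printing Implicit Defensive.

Import GRing.Theory.
Local Open Scope ring_scope.

(* [Quat a b c d] stands for a + b i + c j + d k. *)
Record quat (R : Type) := Quat { q1 : R; qi : R; qj : R; qk : R }.

Definition quat_tuple (R : Type) (x : quat R) : R * R * R * R :=
  (q1 x, qi x, qj x, qk x).
Definition tuple_quat (R : Type) (t : R * R * R * R) : quat R :=
  let: (a, b, c, d) := t in Quat a b c d.
Lemma quat_tupleK (R : Type) : cancel (@quat_tuple R) (@tuple_quat R).
Proof. by case. Qed.

HB.instance Definition _ (R : choiceType) :=
  Choice.copy (quat R) (can_type (@quat_tupleK R)).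

Section QuatAlgebra.
Context {R : realType}.
Implicit Types (x y z : quat R) (r s : R).

Definition zeroh : quat R := Quat 0 0 0 0.
Definition oneh : quat R := Quat 1 0 0 0.
Definition opph x : quat R := Quat (- q1 x) (- qi x) (- qj x) (- qk x).
Definition addh x y : quat R :=
  Quat (q1 x + q1 y) (qi x + qi y) (qj x + qj y) (qk x + qk y).
Definition scaleh r x : quat R :=
  Quat (r * q1 x) (r * qi x) (r * qj x) (r * qk x).
Definition mulh x y : quat R :=
  Quat (q1 x * q1 y - qi x * qi y - qj x * qj y - qk x * qk y)
       (q1 x * qi y + qi x * q1 y + qj x * qk y - qk x * qj y)
       (q1 x * qj y - qi x * qk y + qj x * q1 y + qk x * qi y)
       (q1 x * qk y + qi x * qj y - qj x * qi y + qk x * q1 y).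

Fact addhA : associative addh.
Proof. by move=> x y z; rewrite /addh /= !addrA. Qed.
Fact addhC : commutative addh.
Proof. by move=> x y; congr Quat; rewrite addrC. Qed.
Fact add0h : left_id zeroh addh.
Proof. by case=> a b c d; rewrite /addh /= !add0r. Qed.
Fact addNh : left_inverse zeroh opph addh.
Proof. by move=> x; rewrite /addh /= !addNr. Qed.
HB.instance Definition _ :=
  GRing.isZmodule.Build (quat R) addhA addhC add0h addNh.

Fact mulhA : associative mulh.
Proof. by move=> x y z; congr Quat; rewrite /=; ring. Qed.
Fact mul1h : left_id oneh mulh.
Proof. by case=> a b c d; congr Quat; rewrite /=; ring. Qed.
Fact mulh1 : right_id oneh mulh.
Proof. by case=> a b c d; congr Quat; rewrite /=; ring. Qed.
Fact mulhDl : left_distributive mulh addh.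
Proof. by move=> x y z; congr Quat; rewrite /=; ring. Qed.
Fact mulhDr : right_distributive mulh addh.
Proof. by move=> x y z; congr Quat; rewrite /=; ring. Qed.
Fact oneh_neq0 : oneh != 0.
Proof. by apply/eqP; case=> /eqP; rewrite oner_eq0. Qed.
HB.instance Definition _ :=
  GRing.Zmodule_isNzRing.Build (quat R) mulhA mul1h mulh1 mulhDl mulhDr oneh_neq0.

Fact scalehA r s x : scaleh r (scaleh s x) = scaleh (r * s) x.
Proof. by rewrite /scaleh /= !mulrA. Qed.
Fact scale1h : left_id 1 scaleh.
Proof. by case=> a b c d; rewrite /scaleh /= !mul1r. Qed.
Fact scalehDr : right_distributive scaleh +%R.
Proof. by move=> r x y; congr Quat; rewrite /= mulrDr. Qed.
Fact scalehDl x : {morph scaleh^~ x : r s / r + s}.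
Proof. by move=> r s; congr Quat; rewrite /= mulrDl. Qed.
HB.instance Definition _ :=
  GRing.Zmodule_isLmodule.Build R (quat R) scalehA scale1h scalehDr scalehDl.

Fact scalehAl r x y : r *: (x * y) = (r *: x) * y.
Proof. by congr Quat; rewrite /=; ring. Qed.
HB.instance Definition _ := GRing.Lmodule_isLalgebra.Build R (quat R) scalehAl.

Fact scalehAr r x y : r *: (x * y) = x * (r *: y).
Proof. by congr Quat; rewrite /=; ring. Qed.
HB.instance Definition _ := GRing.Lalgebra_isAlgebra.Build R (quat R) scalehAr.

Definition ih : quat R := Quat 0 1 0 0.
Definition jh : quat R := Quat 0 0 1 0.
Definition kh : quat R := Quat 0 0 0 1.

Lemma quat_basis x : x = (q1 x)%:A + qi x *: ih + qj x *: jh + qk x *: kh.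
Proof. by case: x => a b c d; congr Quat; rewrite /=; ring. Qed.

Lemma quat_sqr : [/\ ih * ih = -1, jh * jh = -1 & kh * kh = -1].
Proof. by split; congr Quat; rewrite /=; ring. Qed.

Lemma quat_mul :
  [/\ ih * jh = kh, jh * kh = ih & kh * ih = jh] /\
  [/\ jh * ih = - kh, kh * jh = - ih & ih * kh = - jh].
Proof. by split; split; congr Quat; rewrite /=; ring. Qed.

End QuatAlgebra.

Section Horadam.
Context {R : realType}.
Implicit Types (w p q : R).

Fixpoint horadam_nat w0 w1 p q (n : nat) : R :=
  match n with
  | 0 => w0
  | 1 => w1
  | (m.+1 as m').+1 => p * horadam_nat w0 w1 p q m' + q * horadam_nat w0 w1 p q m
  end.

(* [horadam_opp w0 w1 p q n] is w_{-n}, from w_{-n} = (w_{-n+2} - p w_{-n+1}) / q. *)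
Fixpoint horadam_opp w0 w1 p q (n : nat) : R :=
  match n with
  | 0 => w0
  | 1 => (w1 - p * w0) / q
  | (m.+1 as m').+1 =>
      (horadam_opp w0 w1 p q m - p * horadam_opp w0 w1 p q m') / q
  end.

Definition horadam w0 w1 p q (n : int) : R :=
  match n with
  | Posz m => horadam_nat w0 w1 p q m
  | Negz m => horadam_opp w0 w1 p q m.+1
  end.

Lemma horadam_rec w0 w1 p q (n : int) : q != 0 ->
  horadam w0 w1 p q n =
    p * horadam w0 w1 p q (n - 1) + q * horadam w0 w1 p q (n - 2).
Proof.
move=> q0; case: n => [[|[|n]]|n].
- by rewrite (_ : 0%N%:Z - 1 = Negz 0) // (_ : 0%N%:Z - 2 = Negz 1) //=; field.
- by rewrite (_ : 1%N%:Z - 1 = 0%N) // (_ : 1%N%:Z - 2 = Negz 0) //=; field.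
- have -> : n.+2%:Z - 1 = n.+1 by rewrite -addn1 PoszD addrK.
  by have -> : n.+2%:Z - 2 = n by rewrite -addn2 PoszD addrK.
have -> : Negz n - 1 = Negz n.+1 by rewrite !NegzE -opprD -PoszD addn1.
have -> : Negz n - 2 = Negz n.+2 by rewrite !NegzE -opprD -PoszD addn2.
by case: n => [|n] /=; field.
Qed.

Lemma horadam_negE w0 w1 p q (n : nat) : q != 0 ->
  (- q) ^+ n * horadam w0 w1 p q (- n%:Z) =
    w0 * horadam 0 1 p q n.+1 - w1 * horadam 0 1 p q n.
Proof.
move=> q0.
have E m : horadam w0 w1 p q (- m%:Z) = horadam_opp w0 w1 p q m.
  by case: m => // m; rewrite -NegzE.
suff [] : (- q) ^+ n * horadam w0 w1 p q (- n%:Z) =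
    w0 * horadam 0 1 p q n.+1 - w1 * horadam 0 1 p q n /\
  (- q) ^+ n.+1 * horadam w0 w1 p q (- n.+1%:Z) =
    w0 * horadam 0 1 p q n.+2 - w1 * horadam 0 1 p q n.+1 by [].
rewrite !E; elim: n => [|n [IH1 IH2]].
  by rewrite /=; split; [ring | field].
split => //.
have -> : (- q) ^+ n.+2 * horadam_opp w0 w1 p q n.+2 =
  q * ((- q) ^+ n * horadam_opp w0 w1 p q n) +
  p * ((- q) ^+ n.+1 * horadam_opp w0 w1 p q n.+1).
  rewrite (_ : horadam_opp w0 w1 p q n.+2 =
    (horadam_opp w0 w1 p q n - p * horadam_opp w0 w1 p q n.+1) / q) //.
  by rewrite !exprS; field.
rewrite IH1 IH2.
have u_rec m : horadam 0 1 p q m.+2 =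
  p * horadam 0 1 p q m.+1 + q * horadam 0 1 p q m by [].
by rewrite (u_rec n.+1) (u_rec n); ring.
Qed.

Definition horadam_quat w0 w1 p q (n : int) : quat R :=
  let w := horadam w0 w1 p q in
  (w n)%:A + w (n + 1) *: ih + w (n + 2) *: jh + w (n + 3) *: kh.

End Horadam.

(* Main.v *)
Require Import Defs.
From mathcomp Require Import all_boot all_order all_algebra reals.
From mathcomp Require Import ring.

Import GRing.Theory.

Local Open Scope ring_scope.

(** Let [T] be the shift operator on sequences indexed by the integers. The
    recurrence of the Horadam quaternions reads [(p - T) W = - q T^-1 W], and
    the theorem is the binomial expansion of [(p - T)^n W]. *)

Section BinomialShift.
Variables (R : comNzRingType) (V : lmodType R).

(** The value at [m] of [(p - T)^n W], written out by the binomial theorem. *)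
Definition binomial_shift (p : R) (n : nat) (W : int -> V) (m : int) : V :=
  \sum_(j < n.+1) ('C(n, j)%:R * (-1) ^+ j * p ^+ (n - j)) *: W (j%:Z + m).

Lemma binomial_shift0 p W m : binomial_shift p 0 W m = W m.
Proof.
by rewrite /binomial_shift big_ord1 bin0 !expr0 !mulr1 scale1r add0r.
Qed.

(** This is [(p - T)^(n+1) = (p - T) (p - T)^n]; on coefficients it is Pascal's rule. *)
Lemma binomial_shiftS p n W m :
  binomial_shift p n.+1 W m =
  p *: binomial_shift p n W m - binomial_shift p n W (m + 1).
Proof.
(* The added term [j = n.+1] vanishes because ['C(n, n.+1) = 0]; the range now agrees with that of
   the left-hand side. *)
have -> : p *: binomial_shift p n W m =
    \sum_(j < n.+2) ('C(n, j)%:R * (-1) ^+ j * p ^+ (n.+1 - j)) *: W (j%:Z + m).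
  rewrite big_ord_recr /= bin_small // !mul0r scale0r addr0 scaler_sumr.
  apply: eq_bigr => j _; rewrite scalerA subSn; last exact: ltn_ord j.
  by congr (_ *: _); rewrite exprS; ring.
(* Once the terms at index [0] are split off, term [j.+1] of the long sums pairs with term [j] of
   the shifted sum. *)
rewrite /binomial_shift big_ord_recl [in RHS]big_ord_recl /= !bin0 -addrA.
congr (_ + _); rewrite -sumrB; apply: eq_bigr => j _.
rewrite /bump /= add1n subSS binS.
have -> : j.+1%:Z + m = j%:Z + (m + 1) by rewrite -addn1 PoszD; ring.
by rewrite -scalerBl; congr (_ *: _); rewrite natrD exprS; ring.
Qed.

Lemma binomial_shift_recurrence p q (W : int -> V) :
    (forall m, W m = p *: W (m - 1) + q *: W (m - 2)) ->
  forall n m, binomial_shift p n W m = (- q) ^+ n *: W (- n%:Z + m).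
Proof.
move=> W_rec; elim=> [|n IHn] m.
  by rewrite binomial_shift0 expr0 scale1r oppr0 add0r.
(* Expanding the shifted term, of index [m + 1 - n], produces [p *: W (m - n)], which cancels the
   other term. *)
rewrite binomial_shiftS !IHn (W_rec (- n%:Z + (m + 1))).
have -> : - n%:Z + (m + 1) - 1 = - n%:Z + m by ring.
have -> : - n%:Z + (m + 1) - 2 = - n.+1%:Z + m by rewrite -(addn1 n) PoszD; ring.
rewrite scalerDr opprD addrA !scalerA (mulrC p) subrr add0r -scaleNr.
by rewrite exprS; congr (_ *: _); ring.
Qed.

End BinomialShift.

Lemma horadam_quatE (R : realType) (w0 w1 p q : R) (m : int) :
  let w := horadam w0 w1 p q in
  horadam_quat w0 w1 p q m = Quat (w m) (w (m + 1)) (w (m + 2)) (w (m + 3)).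
Proof. by move=> w; rewrite [RHS]quat_basis. Qed.

(** Each coordinate is a shift of the scalar sequence, whose recurrence holds at every integer index
    when [q] is invertible. *)
Lemma horadam_quat_rec (R : realType) (w0 w1 p q : R) (m : int) : q != 0 ->
  horadam_quat w0 w1 p q m =
  p *: horadam_quat w0 w1 p q (m - 1) + q *: horadam_quat w0 w1 p q (m - 2).
Proof.
move=> q0; rewrite !horadam_quatE.
by congr Quat; rewrite horadam_rec //=;
  congr (_ * horadam _ _ _ _ _ + _ * horadam _ _ _ _ _); ring.
Qed.

Theorem theorem3p2 (R : realType) (p q w0 w1 : R) (hq : q != 0) (n k : nat) :
  let W := horadam_quat w0 w1 p q in
  \sum_(j < n.+1) ('C(n, j)%:R * (-1) ^+ j * p ^+ (n - j)) *: W (j%:Z + k%:Z) =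
  (- q) ^+ n *: W (- n%:Z + k%:Z).
Proof.
move=> W; apply: (@binomial_shift_recurrence R (quat R)) => m.
exact: horadam_quat_rec.
Qed.
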